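(* Consider D$^2$/Exact-Diffusion for decentralized stochastic optimization with $n$ nodes, a symmetric doubly stochastic weight matrix $W$ of a strongly connected network, each $f_i$ convex and $L$-smooth, unbiased stochastic gradients with variance at most $\sigma^2$ independent over nodes and iterations, $\bar\lambda_n=(1+\lambda_n(W))/2$ bounded away from $0$, and the learning rate (specified in the context) for which the algorithm has the guarantee $$\frac1{T+1}\sum_{k=0}^T\big(\mathbb E f(\bar x^{(k)})-f(x^\star)\big)=O\Big(\frac{\sigma}{\sqrt{nT}}+\frac{\sigma^{2/3}}{(1-\beta)^{1/3}T^{2/3}}+\frac1{(1-\beta)T}\Big).$$ Then the transient stage of D$^2$/Exact-Diffusion is on the order of $\Omega\big(\frac{n^3}{(1-\beta)^2}\big)$.
   Context: Problem: $f=\frac1n\sum_{i=1}^n f_i$ with $f_i(x)=\mathbb E_{\xi_i\sim D_i}F(x;\xi_i)$, $x\in\mathbb R^d$; $x^\star$ a minimizer of $f$. Eigenvalues of $W$: $1=\lambda_1(W)>\lambda_2(W)\ge\dots\ge\lambda_n(W)>-1$; $\beta=\max\{|\lambda_2(W)|,|\lambda_n(W)|\}<1$; $\bar W=(I+W)/2$; $\bar\lambda_i=(1+\lambda_i(W))/2$; $\beta_1=\bar\lambda_2^{1/2}$; $V=(I-\bar W)^{1/2}$. Algorithm: with $\mathbf x^{(k)}\in\mathbb R^{n\times d}$ having rows $(x_i^{(k)})^T$, $\mathbf x^{(0)}=\mathbf y^{(0)}=0$: $\mathbf x^{(k+1)}=\bar W(\mathbf x^{(k)}-\gamma\nabla F(\mathbf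 x^{(k)};\boldsymbol\xi^{(k)}))-V\mathbf y^{(k)}$, $\mathbf y^{(k+1)}=\mathbf y^{(k)}+V\mathbf x^{(k+1)}$, where the $i$-th row of $\nabla F(\mathbf x^{(k)};\boldsymbol\xi^{(k)})$ is $\nabla F(x_i^{(k)};\xi_i^{(k)})^T$; $\bar x^{(k)}=\frac1n\sum_ix_i^{(k)}$. Learning rate: $\gamma=\min\{\frac1{4L},\frac{(1-\beta_1)\bar\lambda_n^{1/2}}{10L\bar\lambda_2},(\frac{r_0}{r_1(T+1)})^{1/2},(\frac{r_0}{r_2(T+1)})^{1/3},(\frac{r_0}{r_3})^{1/3}\}$ with $r_0=2\mathbb E\|\bar x^{(0)}-x^\star\|^2$, $r_1=\frac{2\sigma^2}n$, $r_2=\frac{24L\bar\lambda_2^2\sigma^2}{(1-\beta_1)\bar\lambda_n}$, $r_3=\frac{18L\bar\lambda_2^2\sum_i\|\nabla f_i(x^\star)\|^2}{n(1-\beta_1)(1-\beta)\bar\lambda_n}$. Transient stage: the number of iterations $T$ needed to reach the linear-speedup stage, i.e. the order of the smallest $T$ from which on the term of the rate bound involving $nT$, here $\frac{\sigma}{\sqrt{nT}}$, dominates each of the other terms of the bound up to absolute constants. The order is expressed in $n$ and $1-\beta$, with $\sigma>0$ treated as a constant. *)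

(* Defs.v *)
(* MathComp / MathComp-Analysis *)
From HB Require Import structures.
From mathcomp Require Import all_boot all_order all_algebra.
From mathcomp Require Import all_classical all_reals all_analysis.

Set Implicit Arguments.
Unset Strict Implicit.
Unset Printing Implicit Defensive.

Import Order.TTheory GRing.Theory Num.Theory.
Import numFieldNormedType.Exports.
Local Open Scope classical_set_scope.
Local Open Scope ring_scope.

(* Points of R^d are row vectors, so that row i of the stacked n x d iterate is
   the i-th node's point.  The library norm on 'rV[R]_d is the sup norm, whence
   the explicit Euclidean norm. *)
Definition normsq (R : realType) (d : nat) (v : 'rV[R]_d) : R :=
  \sum_(j < d) v 0 j ^+ 2.

Definition enorm (R : realType) (d : nat) (v : 'rV[R]_d) : R :=
  Num.sqrt (normsq v).

Definition grad (R : realType) (d : nat) (f : 'rV[R]_d -> R) (x : 'rV[R]_d)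
  : 'rV[R]_d := \row_(j < d) 'D_(delta_mx 0 j) f x.

Definition smooth (R : realType) (d : nat) (L : R) (f : 'rV[R]_d -> R) : Prop :=
  (forall x, differentiable f x) /\
  (forall x y, enorm (grad f x - grad f y) <= L * enorm (x - y)).

Definition is_minimizer (R : realType) (d : nat) (f : 'rV[R]_d -> R)
  (xstar : 'rV[R]_d) : Prop := forall x, f xstar <= f x.

Definition doubly_stochastic (R : realType) (n : nat) (W : 'M[R]_n) : Prop :=
  [/\ forall i j, 0 <= W i j,
      forall i, \sum_(j < n) W i j = 1
    & forall j, \sum_(i < n) W i j = 1].

(* The links of the network are the pairs of nodes with positive weight. *)
Definition strongly_connected (R : realType) (n : nat) (W : 'M[R]_n) : Prop :=
  forall i j : 'I_n, connect [rel k l | 0 < W k l] i j.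

(* Eigenvalues with multiplicity, in nonincreasing order:
   lambda_k is lam`_(k-1). *)
Definition is_spectrum (R : realType) (n : nat) (W : 'M[R]_n) (lam : seq R)
  : Prop :=
  [/\ size lam = n,
      char_poly W = \prod_(a <- lam) ('X - a%:P)
    & sorted >=%R lam].

Definition mixing_matrix (R : realType) (n : nat) (W : 'M[R]_n) (lam : seq R)
  : Prop :=
  [/\ W^T = W, doubly_stochastic W, strongly_connected W, is_spectrum W lam
    & [/\ lam`_0 = 1, lam`_1 < 1 & -1 < lam`_n.-1]].

Definition beta (R : realType) (n : nat) (lam : seq R) : R :=
  Num.max `|lam`_1| `|lam`_n.-1|.

Definition barW (R : realType) (n : nat) (W : 'M[R]_n) : 'M[R]_n :=
  2^-1 *: (1%:M + W).

Definition barlam2 (R : realType) (lam : seq R) : R := (1 + lam`_1) / 2.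

Definition barlamn (R : realType) (n : nat) (lam : seq R) : R :=
  (1 + lam`_n.-1) / 2.

Definition beta1 (R : realType) (lam : seq R) : R := Num.sqrt (barlam2 lam).

(* V is the positive semidefinite square root of A. *)
Definition is_psd_sqrt (R : realType) (n : nat) (A V : 'M[R]_n) : Prop :=
  [/\ V^T = V, forall u : 'rV[R]_n, 0 <= (u *m V *m u^T) 0 0 & V *m V = A].

Definition local_obj (R : realType) (d : nat) (dXi : measure_display)
  (Xi : measurableType dXi) (F : 'rV[R]_d -> Xi -> R) (D : probability Xi R)
  (x : 'rV[R]_d) : R := fine ('E_D[F x])%E.

Definition global_obj (R : realType) (n d : nat) (dXi : measure_display)
  (Xi : measurableType dXi) (F : 'rV[R]_d -> Xi -> R)
  (D : 'I_n -> probability Xi R) (x : 'rV[R]_d) : R :=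
  n%:R^-1 * \sum_(i < n) local_obj F (D i) x.

(* F(.; z) differentiable and F(x; .) integrable make the gradient in x jointly
   measurable in (x, z), so no separate measurability assumption is needed. *)
Definition well_defined_loss (R : realType) (d : nat) (dXi : measure_display)
  (Xi : measurableType dXi) (F : 'rV[R]_d -> Xi -> R) (D : probability Xi R)
  : Prop :=
  (forall x, D.-integrable setT (EFin \o F x)) /\
  (forall x z, differentiable (F^~ z) x).

Definition unbiased_gradient (R : realType) (d : nat) (dXi : measure_display)
  (Xi : measurableType dXi) (F : 'rV[R]_d -> Xi -> R) (D : probability Xi R)
  : Prop :=
  forall (x : 'rV[R]_d) (j : 'I_d),
    ('E_D[fun z => (grad (F^~ z) x 0 j)%R] = (grad (local_obj F D) x 0 j)%R%:E)%E.

Definition bounded_variance (R : realType) (d : nat) (dXi : measure_display)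
  (Xi : measurableType dXi) (F : 'rV[R]_d -> Xi -> R) (D : probability Xi R)
  (sigma : R) : Prop :=
  forall x : 'rV[R]_d,
    ('E_D[fun z => normsq (grad (F^~ z) x - grad (local_obj F D) x)%R]
       <= (sigma ^+ 2)%:E)%E.

Definition mutually_independent (R : realType) (I : eqType)
  (dO dXi : measure_display) (Omega : measurableType dO)
  (Xi : measurableType dXi) (P : probability Omega R) (X : I -> Omega -> Xi)
  : Prop :=
  forall (s : seq I) (A : I -> set Xi),
    uniq s -> (forall i, measurable (A i)) ->
    P (\bigcap_(i in [set` s]) (X i @^-1` A i)) =
    (\big[*%E/1%E]_(i <- s) P (X i @^-1` A i))%E.

(* xi i k is the sample drawn by node i at iteration k. *)
Definition sampling_scheme (R : realType) (n : nat) (dO dXi : measure_display)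
  (Omega : measurableType dO) (Xi : measurableType dXi)
  (P : probability Omega R) (D : 'I_n -> probability Xi R)
  (xi : 'I_n -> nat -> {mfun Omega >-> Xi}) : Prop :=
  (forall i k A, measurable A -> distribution P (xi i k) A = D i A) /\
  mutually_independent P (fun (p : 'I_n * nat) (w : Omega) => xi p.1 p.2 w).

Definition stoch_grad (R : realType) (n d : nat) (Xi : Type)
  (F : 'rV[R]_d -> Xi -> R) (z : 'I_n -> Xi) (x : 'M[R]_(n, d))
  : 'M[R]_(n, d) :=
  \matrix_(i < n, j < d) grad (F^~ (z i)) (row i x) 0 j.

Definition d2_init (R : realType) (n d : nat) : 'M[R]_(n, d) := 0.

(* The pair (x^(k), y^(k)); z i k is the sample of node i at iteration k. *)
Fixpoint d2_state (R : realType) (n d : nat) (Xi : Type) (W V : 'M[R]_n)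
  (F : 'rV[R]_d -> Xi -> R) (gamma : R) (z : 'I_n -> nat -> Xi) (k : nat)
  : 'M[R]_(n, d) * 'M[R]_(n, d) :=
  if k is k'.+1 then
    let: (x, y) := d2_state W V F gamma z k' in
    let x' :=
      barW W *m (x - gamma *: stoch_grad F (fun i => z i k') x) - V *m y in
    (x', y + V *m x')
  else (d2_init R n d, d2_init R n d).

Definition node_mean (R : realType) (n d : nat) (x : 'M[R]_(n, d))
  : 'rV[R]_d := n%:R^-1 *: \sum_(i < n) row i x.

Definition d2_mean (R : realType) (n d : nat) (Omega Xi : Type)
  (W V : 'M[R]_n) (F : 'rV[R]_d -> Xi -> R) (gamma : R)
  (xi : 'I_n -> nat -> Omega -> Xi) (k : nat) (w : Omega) : 'rV[R]_d :=
  node_mean (d2_state W V F gamma (fun i l => xi i l w) k).1.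

(* Step size for horizon T.  Division by zero is 0 in MathComp, so the last
   entry of the minimum, which is +oo when r3 = 0 (no heterogeneity), is dropped
   in that case. *)
Definition d2_learning_rate (R : realType) (n d : nat)
  (dO dXi : measure_display) (Omega : measurableType dO)
  (Xi : measurableType dXi) (P : probability Omega R)
  (F : 'rV[R]_d -> Xi -> R) (D : 'I_n -> probability Xi R)
  (xstar : 'rV[R]_d) (lam : seq R) (L sigma : R) (T : nat) : R :=
  let bl2 := barlam2 lam in
  let bln := barlamn n lam in
  let b1 := beta1 lam in
  let r0 :=
    2 * fine ('E_P[fun=> normsq (node_mean (d2_init R n d) - xstar)%R])%E in
  let r1 := 2 * sigma ^+ 2 / n%:R in
  let r2 := 24 * L * bl2 ^+ 2 * sigma ^+ 2 / ((1 - b1) * bln) in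
  let r3 := 18 * L * bl2 ^+ 2 *
      (\sum_(i < n) enorm (grad (local_obj F (D i)) xstar) ^+ 2) /
      (n%:R * (1 - b1) * (1 - beta n lam) * bln) in
  let g :=
    Num.min (1 / (4 * L))
      (Num.min ((1 - b1) * Num.sqrt bln / (10 * L * bl2))
        (Num.min (Num.sqrt (r0 / (r1 * T.+1%:R)))
                 ((r0 / (r2 * T.+1%:R)) `^ 3^-1))) in
  if r3 == 0 then g else Num.min g ((r0 / r3) `^ 3^-1).

Definition mean_suboptimality (R : realType) (d : nat) (dO : measure_display)
  (Omega : measurableType dO) (P : probability Omega R) (f : 'rV[R]_d -> R)
  (xstar : 'rV[R]_d) (xbar : nat -> Omega -> 'rV[R]_d) (T : nat) : \bar R :=
  ((T.+1%:R^-1)%:E *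
    \sum_(0 <= k < T.+1) ('E_P[fun w => f (xbar k w)] - (f xstar)%:E))%E.

Definition speedup_term (R : realType) (sigma : R) (n T : nat) : R :=
  sigma / Num.sqrt (n * T)%:R.

Definition noise_term (R : realType) (sigma b : R) (T : nat) : R :=
  sigma `^ (2 / 3) / ((1 - b) `^ (1 / 3) * T%:R `^ (2 / 3)).

Definition network_term (R : realType) (b : R) (T : nat) : R :=
  1 / ((1 - b) * T%:R).

Definition rate_bound (R : realType) (sigma b : R) (n T : nat) : R :=
  speedup_term sigma n T + noise_term sigma b T + network_term b T.

(* K is the constant hidden in the O of the convergence rate; the step size, and
   hence the whole trajectory, depends on the horizon T. *)
Definition d2_guarantee (R : realType) (n d : nat)
  (dO dXi : measure_display) (Omega : measurableType dO)
  (Xi : measurableType dXi) (P : probability Omega R)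
  (W V : 'M[R]_n) (lam : seq R) (F : 'rV[R]_d -> Xi -> R)
  (D : 'I_n -> probability Xi R) (xi : 'I_n -> nat -> Omega -> Xi)
  (xstar : 'rV[R]_d) (L sigma K : R) : Prop :=
  forall T : nat, (0 < T)%N ->
    let gamma := d2_learning_rate P F D xstar lam L sigma T in
    (mean_suboptimality P (global_obj F D) xstar (d2_mean W V F gamma xi) T
       <= (K * rate_bound sigma (beta n lam) n T)%:E)%E.

(* From iteration T on, the linear-speedup term dominates the two other terms of
   the rate bound, up to the constants C2 and C3. *)
Definition linear_speedup_from (R : realType) (C2 C3 sigma b : R) (n T : nat)
  : Prop :=
  forall t : nat, (T <= t)%N ->
    noise_term sigma b t <= C2 * speedup_term sigma n t /\
    network_term b t <= C3 * speedup_term sigma n t.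

Definition is_transient_stage (R : realType) (C2 C3 sigma b : R) (n T : nat)
  : Prop :=
  [/\ (0 < T)%N,
      linear_speedup_from C2 C3 sigma b n T
    & forall T' : nat, (0 < T')%N -> linear_speedup_from C2 C3 sigma b n T' ->
        (T <= T')%N].

(* Main.v *)
(* For t > 0, taking sixth powers (resp. squares) turns the two domination
   inequalities into t >= n^3 / (C2^6 sigma^2 (1-b)^2) and
   t >= n / (C3^2 sigma^2 (1-b)^2).  The transient stage is the least positive
   integer satisfying both, and the first threshold has the claimed order while
   the second one is smaller by a factor of order n^2. *)
Require Import Defs.
From HB Require Import structures.
From mathcomp Require Import all_boot all_order all_algebra.
From mathcomp Require Import all_classical all_reals all_analysis.
From mathcomp Require Import ring.

Set Implicit Arguments.
Unset Strict Implicit.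
Unset Printing Implicit Defensive.

Import Order.TTheory GRing.Theory Num.Theory.
Import numFieldNormedType.Exports.
Local Open Scope classical_set_scope.
Local Open Scope ring_scope.

Lemma beta_ge0 (R : realType) (n : nat) (lam : seq R) : 0 <= beta n lam.
Proof. by rewrite /beta le_max normr_ge0. Qed.

(** Since [1 < n], index 1 lies in the list and is at most [n.-1]; sortedness then traps both
    eigenvalues between [lam]_n.-1 > -1[and]lam[_1 < 1]. *)
Lemma mixing_beta_lt1 (R : realType) (n : nat) (W : 'M[R]_n) (lam : seq R) :
  (1 < n)%N -> mixing_matrix W lam -> beta n lam < 1.
Proof.
move=> n_gt1 [_ _ _ [size_lam _ sorted_lam] [_ lam1_lt1 lamn_gtN1]].
have lam1_ge : lam`_n.-1 <= lam`_1.
  have ge_tr : transitive (>=%R : rel R).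
    by move=> y x z /= y_le_x z_le_y; apply: le_trans z_le_y y_le_x.
  apply: (sorted_leq_nth ge_tr (@lexx _ R) 0 sorted_lam).
  - by rewrite inE size_lam.
  - by rewrite inE size_lam prednK // ltnW.
  - by rewrite -ltnS prednK // ltnW.
rewrite /beta gt_max !ltr_norml lam1_lt1 lamn_gtN1 !andbT.
by rewrite (lt_le_trans lamn_gtN1 lam1_ge) (le_lt_trans lam1_ge lam1_lt1).
Qed.

(** Clears a rational exponent [p = k/m], so that polynomial identities can be left to [ring]. *)
Lemma powR_expn (R : realType) (a p : R) (m k : nat) :
  0 <= a -> p * m%:R = k%:R -> (a `^ p) ^+ m = a ^+ k.
Proof.
by move=> a_ge0 pmk; rewrite -powR_mulrn ?powR_ge0// -powRrM pmk powR_mulrn.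
Qed.

(** Six is the least common multiple of the denominators 3 and 2 of the exponents; both sides are
    nonnegative, so raising to this power loses nothing. *)
Lemma noise_le_speedup (R : realType) (C sigma b : R) (n t : nat) :
  0 < C -> 0 < sigma -> b < 1 -> (0 < n)%N -> (0 < t)%N ->
  (noise_term sigma b t <= C * speedup_term sigma n t) =
  (n%:R ^+ 3 / (C ^+ 6 * sigma ^+ 2 * (1 - b) ^+ 2) <= t%:R).
Proof.
move=> C_gt0 s_gt0 b_lt1; rewrite -(ltr0n R) -(ltr0n R t) => n_gt0 t_gt0.
have q_gt0 : 0 < 1 - b by rewrite subr_gt0.
have nt_ge0 : 0 <= (n%:R * t%:R : R) by rewrite mulr_ge0 ?ltW.
rewrite -(@ler_pXn2r _ 6) ?nnegrE //; first last.
- by rewrite mulr_ge0 ?divr_ge0 ?sqrtr_ge0 ?ltW.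
- by rewrite divr_ge0 ?mulr_ge0 ?powR_ge0.
rewrite /noise_term /speedup_term natrM !(expr_div_n, exprMn).
have -> : (sigma `^ (2 / 3)) ^+ 6 = sigma ^+ 4.
  by apply: powR_expn; [exact: ltW|field].
have -> : ((1 - b) `^ (1 / 3)) ^+ 6 = (1 - b) ^+ 2.
  by apply: powR_expn; [exact: ltW|field].
have -> : (t%:R `^ (2 / 3)) ^+ 6 = t%:R ^+ 4 :> R.
  by apply: powR_expn; [exact: ltW|field].
rewrite [Num.sqrt _ ^+ 6](exprM _ 2 3) sqr_sqrtr // [C ^+ _ * (_ / _)]mulrA.
rewrite !ler_pdivrMr ?mulr_gt0 ?exprn_gt0 // [_ / _ * _]mulrAC.
rewrite ler_pdivlMr ?exprn_gt0 ?mulr_gt0 //.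
(* With denominators cleared, the positive factor [sigma ^+ 4 * t%:R ^+ 3] is common to both sides
   and a single power of [t] survives. *)
have -> : sigma ^+ 4 * (n%:R * t%:R) ^+ 3 =
  (sigma ^+ 4 * t%:R ^+ 3) * n%:R ^+ 3 by ring.
have -> : C ^+ 6 * sigma ^+ 6 * ((1 - b) ^+ 2 * t%:R ^+ 4) =
  (sigma ^+ 4 * t%:R ^+ 3) * (t%:R * (C ^+ 6 * sigma ^+ 2 * (1 - b) ^+ 2))
  by ring.
by rewrite ler_pM2l // mulr_gt0 ?exprn_gt0.
Qed.

Lemma network_le_speedup (R : realType) (C sigma b : R) (n t : nat) :
  0 < C -> 0 < sigma -> b < 1 -> (0 < n)%N -> (0 < t)%N ->
  (network_term b t <= C * speedup_term sigma n t) =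
  (n%:R / (C ^+ 2 * sigma ^+ 2 * (1 - b) ^+ 2) <= t%:R).
Proof.
move=> C_gt0 s_gt0 b_lt1; rewrite -(ltr0n R) -(ltr0n R t) => n_gt0 t_gt0.
have q_gt0 : 0 < 1 - b by rewrite subr_gt0.
have nt_ge0 : 0 <= (n%:R * t%:R : R) by rewrite mulr_ge0 ?ltW.
rewrite -(@ler_pXn2r _ 2) ?nnegrE //; first last.
- by rewrite mulr_ge0 ?divr_ge0 ?sqrtr_ge0 ?ltW.
- by rewrite divr_ge0 ?mulr_ge0 ?ltW.
rewrite /network_term /speedup_term natrM !(expr_div_n, exprMn).
rewrite sqr_sqrtr // [C ^+ _ * (_ / _)]mulrA.
rewrite !ler_pdivrMr ?mulr_gt0 ?exprn_gt0 // [_ / _ * _]mulrAC.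
rewrite ler_pdivlMr ?mulr_gt0 // expr1n mul1r.
have -> : C ^+ 2 * sigma ^+ 2 * ((1 - b) ^+ 2 * t%:R ^+ 2) =
  t%:R * (C ^+ 2 * sigma ^+ 2 * (1 - b) ^+ 2) * t%:R by ring.
by rewrite ler_pM2r.
Qed.

Lemma exists_least_pos_nat_ge (R : realType) (X : R) :
  exists T : nat, [/\ (0 < T)%N, X <= T%:R,
    forall t : nat, (0 < t)%N -> X <= t%:R -> (T <= t)%N
    & T%:R <= Num.max X 0 + 1].
Proof.
have exT : exists t : nat, (0 < t)%N && (X <= t%:R).
  by exists (Num.truncn X).+1; rewrite ltW ?truncnS_gt.
have [T /andP[T_gt0 X_le] T_min] := ex_minnP exT.
exists T; split=> // [t t_gt0 X_le_t|]; first by apply: T_min; rewrite t_gt0.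
(* If the least value is 1, the maximum with 0 gives the bound even for negative [X]. Otherwise its
   predecessor is still positive, so by minimality it lies below [X]. *)
case: T T_gt0 T_min {X_le} => // -[_ _|T _ T_min].
  by rewrite lerDr le_max lexx orbT.
rewrite -[T.+2]addn1 natrD lerD2r le_max ltW // ltNge.
by apply/negP => X_le; have := T_min T.+1 X_le; rewrite ltnn.
Qed.

Theorem corollary1 (R : realType) (sigma C2 C3 : R)
    (sigma_gt0 : 0 < sigma) (C2_gt0 : 0 < C2) (C3_gt0 : 0 < C3) :
  exists c1 c2 : R, [/\ 0 < c1, 0 < c2 &
    forall (L delta K : R) (n d : nat) (W V : 'M[R]_n) (lam : seq R)
      (dXi dO : measure_display) (Xi : measurableType dXi)
      (Omega : measurableType dO) (P : probability Omega R)
      (F : 'rV[R]_d -> Xi -> R) (D : 'I_n -> probability Xi R)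
      (xi : 'I_n -> nat -> {mfun Omega >-> Xi}) (xstar : 'rV[R]_d),
    0 < L -> 0 < delta -> 0 < K -> (1 < n)%N ->
    mixing_matrix W lam ->
    delta <= barlamn n lam ->
    is_psd_sqrt (1%:M - barW W) V ->
    (forall i : 'I_n, well_defined_loss F (D i)) ->
    (forall i : 'I_n, convex_function [set: 'rV[R]_d] (local_obj F (D i))) ->
    (forall i : 'I_n, smooth L (local_obj F (D i))) ->
    (forall i : 'I_n, unbiased_gradient F (D i)) ->
    (forall i : 'I_n, bounded_variance F (D i) sigma) ->
    is_minimizer (global_obj F D) xstar ->
    sampling_scheme P D xi ->
    d2_guarantee P W V lam F D (fun i k => xi i k) xstar L sigma K ->
    exists T : nat,
      is_transient_stage C2 C3 sigma (beta n lam) n T /\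
      c1 * (n%:R ^+ 3 / (1 - beta n lam) ^+ 2) <= T%:R
        <= c2 * (n%:R ^+ 3 / (1 - beta n lam) ^+ 2)].
Proof.
pose a := (C2 ^+ 6 * sigma ^+ 2)^-1; pose c := (C3 ^+ 2 * sigma ^+ 2)^-1.
have a_gt0 : 0 < a by rewrite invr_gt0 mulr_gt0 ?exprn_gt0.
have c_gt0 : 0 < c by rewrite invr_gt0 mulr_gt0 ?exprn_gt0.
(* The thresholds will be [a * A] and [c * B] with [B <= A]; the summand 1 pays for rounding up to
   an integer. Both constants depend only on [sigma], [C2], [C3], hence are uniform in the
   network. *)
exists a, (a + c + 1); split; rewrite ?addr_gt0 //.
move=> L delta K n d W V lam dXi dO Xi Omega P F D xi xstar.
move=> _ _ _ n_gt1 W_mixing _ _ _ _ _ _ _ _ _ _.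
have b_ge0 := beta_ge0 n lam; have b_lt1 := mixing_beta_lt1 n_gt1 W_mixing.
move: (beta n lam) b_ge0 b_lt1 => b b_ge0 b_lt1.
have n_gt0 := ltnW n_gt1.
have q_gt0 : 0 < 1 - b by rewrite subr_gt0.
have q2_gt0 : 0 < (1 - b) ^+ 2 by rewrite exprn_gt0.
set A := n%:R ^+ 3 / (1 - b) ^+ 2.
pose B := n%:R / (1 - b) ^+ 2.
have n_ge1 : 1 <= n%:R :> R by rewrite ler1n.
have B_le_A : B <= A.
  by rewrite ler_pM2r ?invr_gt0 // -[leLHS]expr1 ler_weXn2l.
(* From [0 <= b < 1] one gets [(1 - b) ^+ 2 <= 1 <= n]. *)
have B_ge1 : 1 <= B.
  rewrite ler_pdivlMr // mul1r (le_trans _ n_ge1) // exprn_ile1 ?(ltW q_gt0) //.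
  by rewrite gerBl.
have A_ge1 := le_trans B_ge1 B_le_A.
have dominates t : (0 < t)%N ->
    (noise_term sigma b t <= C2 * speedup_term sigma n t /\
     network_term b t <= C3 * speedup_term sigma n t)
    <-> Num.max (a * A) (c * B) <= t%:R.
  move=> t_gt0; rewrite noise_le_speedup // network_le_speedup // ge_max.
  have -> : n%:R ^+ 3 / (C2 ^+ 6 * sigma ^+ 2 * (1 - b) ^+ 2) = a * A.
    by rewrite invfM mulrCA.
  have -> : n%:R / (C3 ^+ 2 * sigma ^+ 2 * (1 - b) ^+ 2) = c * B.
    by rewrite invfM mulrCA.
  by split=> [[-> ->]|/andP[]].
have [T [T_gt0 X_le_T T_min T_le]] :=
  exists_least_pos_nat_ge (Num.max (a * A) (c * B)).
(* The threshold condition is upward closed in [t], so it persists from [T] on; for minimality,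
   domination at [t = T'] alone suffices. *)
exists T; split; first split=> // [t T_le_t|T' T'_gt0 /(_ T' (leqnn _))].
- apply/dominates; first exact: leq_trans T_le_t.
  by rewrite (le_trans X_le_T) ?ler_nat.
- by move/(dominates _ T'_gt0); apply: T_min.
have := X_le_T; rewrite ge_max => /andP[-> _] /=.
(* The rounding term 1 is absorbed by [A >= 1]; each of [a * A], [c * B] and 0 is at most
   [a * A + c * A]. *)
apply: (le_trans T_le); rewrite mulrDl mul1r lerD // mulrDl !ge_max.
have aA_ge0 : 0 <= a * A by rewrite mulr_ge0 ?ltW // (lt_le_trans ltr01).
have cA_ge0 : 0 <= c * A by rewrite mulr_ge0 ?ltW // (lt_le_trans ltr01).
rewrite lerDl cA_ge0 addr_ge0 //= andbT.
by apply: (@le_trans _ _ (c * A)); rewrite ?lerDr // ler_pM2l.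
Qed.
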